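(* Let $n_1,n_2,n_3\ge 1$ be integers, $N=n_1+n_2+n_3$, and let $k$ be an integer with $1\le k\le N/2$. Put $$m_L:=\max\{0,\,k-n_3\},\qquad m_U:=\min\{n_1,\,n_2,\,k,\,n_1+n_2-k\},$$ and assume $m_L\le m_U$. Let $g_2\in\mathcal S_N$ be the transposition $(1,\;n_1+1)$. Then $$\Phi^{[N-k,k]}(g_2)=\frac{1}{n_1n_2}\sum_{m=m_L}^{m_U}\bigl\{(m-n_1)(m-n_2)-m\bigr\}.$$ Equivalently, with $\mu:=m_U-m_L$, $$\Phi^{[N-k,k]}(g_2)=\frac{\mu+1}{n_1n_2}\left(m_L^2+n_1n_2-\Bigl(m_L+\frac{\mu}{2}\Bigr)(n_1+n_2)+\Bigl(m_L+\frac{\mu}{3}\Bigr)(\mu-1)\right).$$ In particular, if $k\le\min\{n_1,n_2,n_3\}$ then $m_L=0$, $m_U=k$ and $$\Phi^{[N-k,k]}(g_2)=\frac{k+1}{n_1n_2}\left(n_1n_2-\frac12 k(n_1+n_2)+\frac13 k(k-1)\right).$$ The values at the transpositions $(n_1+1,\;n_1+n_2+1)$ and $(1,\;n_1+n_2+1)$ are given by the same formulas after correspondingly permuting the parameters $n_1,n_2,n_3$ (so that the two intervals met by the transposition play the roles of $n_1,n_2$ and the remaining one plays the role of $n_3$, also in the definitions of $m_L$ and $m_U$).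
   Context: $\mathcal S_N$ is the symmetric group on $\{1,\dots,N\}$. Let $I_1=\{1,\dots,n_1\}$, $I_2=\{n_1+1,\dots,n_1+n_2\}$, $I_3=\{n_1+n_2+1,\dots,N\}$, and let $G_{\mathbf n}\cong\mathcal S_{n_1}\times\mathcal S_{n_2}\times\mathcal S_{n_3}$ be the Young subgroup of $\mathcal S_N$ leaving each of $I_1,I_2,I_3$ setwise invariant. For a partition $\tau$ of $N$ let $\chi^\tau$ be the character of the irreducible representation of $\mathcal S_N$ of isotype $\tau$. The spherical function is $$\Phi^\tau(g):=\frac{1}{\#G_{\mathbf n}}\sum_{h\in G_{\mathbf n}}\chi^\tau(gh),\qquad g\in\mathcal S_N,\qquad \#G_{\mathbf n}=n_1!\,n_2!\,n_3!.$$ $[N-k,k]$ denotes the two-row partition of $N$ with parts $N-k$ and $k$ (an irreducible representation of degree $\binom Nk-\binom N{k-1}$). *)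

(* Defs.v *)
From HB Require Import structures.
From mathcomp Require Import all_boot all_order all_algebra all_fingroup all_solvable all_field all_character.
Set Implicit Arguments.
Unset Strict Implicit.
Unset Printing Implicit Defensive.
Import Order.TTheory GRing.Theory Num.Theory.
Local Open Scope ring_scope.

(* Throughout, {1, ..., N} is encoded as 'I_N = {0, ..., N-1}, and the full
   symmetric group is [set: 'S_N]. *)

Section Specht.

Variables (N : nat) (sh : seq nat).

(* sh is meant to be a partition of N. The standard tableau of shape sh used
   here is the one filled with 0, ..., N-1 row after row, so that the entry i
   sits in row (reshape_index sh i) and column (reshape_offset sh i). *)

Definition row_stab : {set 'S_N} :=
  [set p : 'S_N | [forall i : 'I_N, reshape_index sh (p i) == reshape_index sh i]].

Definition col_stab : {set 'S_N} :=
  [set q : 'S_N | [forall i : 'I_N, reshape_offset sh (q i) == reshape_offset sh i]].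

(* The Young symmetrizer \sum_p \sum_q sgn(q) p q, as a vector of the
   regular representation of 'S_N. *)
Definition young_symmetrizer : 'rV[algC]_#|[set: 'S_N]%G| :=
  \sum_(p in row_stab) \sum_(q in col_stab)
    (-1) ^+ odd_perm q *: delta_mx 0 (gring_index [set: 'S_N]%G (p * q)%g).

(* The regular representation acts by right multiplication, so the Specht
   module is the right ideal generated by the Young symmetrizer. *)
Definition specht_repr :=
  submod_repr (cyclic_mx_module (regular_repr algC [set: 'S_N]%G)
                                young_symmetrizer).

Definition specht_char : 'CF([set: 'S_N]%G) := cfRepr specht_repr.

End Specht.

Section Spherical.

Variables n1 n2 n3 : nat.

Definition interval1 : {set 'I_(n1 + n2 + n3)} :=
  [set i : 'I_(n1 + n2 + n3) | (i < n1)%N].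
Definition interval2 : {set 'I_(n1 + n2 + n3)} :=
  [set i : 'I_(n1 + n2 + n3) | (n1 <= i < n1 + n2)%N].
Definition interval3 : {set 'I_(n1 + n2 + n3)} :=
  [set i : 'I_(n1 + n2 + n3) | (n1 + n2 <= i)%N].

Definition young_subgroup : {set 'S_(n1 + n2 + n3)} :=
  ('N(interval1 | 'P) :&: 'N(interval2 | 'P) :&: 'N(interval3 | 'P))%g.

Definition spherical (sh : seq nat) (g : 'S_(n1 + n2 + n3)) : algC :=
  #|young_subgroup|%:R^-1 *
    \sum_(h in young_subgroup) specht_char (n1 + n2 + n3) sh (g * h)%g.

End Spherical.

(* These are integers because a + b - k can be negative. *)
Definition mL (c k : nat) : int := Num.max 0 (k%:Z - c%:Z).

Definition mU (a b k : nat) : int :=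
  Num.min (Num.min a%:Z b%:Z) (Num.min k%:Z (a%:Z + b%:Z - k%:Z)).

(* Main.v *)
Require Import Defs.
From HB Require Import structures.
From mathcomp Require Import all_boot all_order all_algebra all_fingroup all_solvable all_field all_character.
From mathcomp Require Import zify ring.
Import Order.TTheory GRing.Theory Num.Theory.
Local Open Scope ring_scope.

(** The character of the Specht module of shape [N-k,k] is the difference
    pi_k - pi_(k-1) of the permutation characters on k-subsets and on
    (k-1)-subsets ([specht_char_two_row]), which turns the spherical function
    into a count of fixed subsets.

    The right ideal generated by the Young symmetrizer maps injectively to the
    permutation module M^k on k-subsets (a tabloid is the set of entries of its
    second row), with image the span of all polytabloids. This span is the
    kernel of the map M^k -> M^(k-1) sending a k-subset to the sum of its
    (k-1)-subsets: a function killed by this map and orthogonal to all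
    polytabloids vanishes ([harmonic_orthogonal_eq0]). The map is onto when
    2k <= N ([up_injective]), hence the traces subtract ([mxtrace_exact]). Both
    vanishing statements are proved in the same way: average the function over
    the stabilizer of a set, after which its values only depend on how a subset
    meets that set, and compare the values at two subsets that differ by the
    exchange of one point.

    To sum pi_k over the coset tG of the Young subgroup G, where t exchanges a
    point of a class of size n1 and a point of a class of size n2, conjugate by
    G: this replaces t by the average over all n1 * n2 such transpositions. The
    group G preserves the profile (a,b,c) of a subset, that is, the sizes of its
    intersections with the three classes, and is transitive on the subsets with
    a given profile. A transposition keeps the profile of A exactly when both
    of its points are in A or both are outside A, which holds for
    a * b + (n1 - a) * (n2 - b) of them. Hence n1 * n2 times the average of
    pi_k is the sum of these numbers over all profiles with a + b + c = k
    ([tperm_sum_profiles]).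

    In the difference of the sums for k and k - 1 all terms cancel except those
    with a + b = k and those with a + b = k - 1 - n3 ([triple_sumS]). For fixed
    a + b = j, the sum over the profiles equals the sum of
    (m - n1)(m - n2) - m over 0 <= m <= min(n1, n2, j, n1 + n2 - j)
    ([pair_sum_eigen]); subtracting the two initial segments leaves
    m_L <= m <= m_U. *)

Set Implicit Arguments.
Unset Strict Implicit.
Unset Printing Implicit Defensive.

(** * Permutations acting on subsets *)

Lemma imset_permM (T : finType) (g h : {perm T}) (A : {set T}) :
  (g * h)%g @: A = h @: (g @: A).
Proof. by rewrite -imset_comp; apply: eq_imset => x; rewrite permM. Qed.

Lemma imset_perm1 (T : finType) (A : {set T}) : (1%g : {perm T}) @: A = A.
Proof. by rewrite (eq_imset _ (@perm1 T)) imset_id. Qed.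

Lemma mem_imset_perm (T : finType) (g : {perm T}) (A : {set T}) x :
  (g x \in g @: A) = (x \in A).
Proof. exact: (mem_imset _ _ perm_inj). Qed.

Lemma card_imset_perm (T : finType) (g : {perm T}) (A : {set T}) :
  #|g @: A| = #|A|.
Proof. exact: (card_imset _ perm_inj). Qed.

Lemma imset_permV_eq (T : finType) (g : {perm T}) (A B : {set T}) :
  (g @: A == B) = (A == g^-1%g @: B).
Proof.
by apply/eqP/eqP => [<-|->]; rewrite -imset_permM ?mulgV ?mulVg imset_perm1.
Qed.

Lemma imset_perm_inj (T : finType) (g : {perm T}) (A B : {set T}) :
  (g @: A == g @: B) = (A == B).
Proof. by rewrite imset_permV_eq -imset_permM mulgV imset_perm1. Qed.

Lemma imset_permD1 (T : finType) (g : {perm T}) (A : {set T}) x :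
  g @: (A :\ x) = g @: A :\ g x.
Proof.
apply/setP=> z; rewrite -(permKV g z) !inE !mem_imset_perm.
by rewrite (inj_eq perm_inj) !inE.
Qed.

Lemma in_imset_tperm (T : finType) (x y z : T) (A : {set T}) :
  (z \in tperm x y @: A) = (tperm x y z \in A).
Proof. by rewrite -{1}(tpermK x y z) mem_imset_perm. Qed.

Lemma imset_tperm_fix (T : finType) (x y : T) (A : {set T}) :
  (x \in A) = (y \in A) -> tperm x y @: A = A.
Proof.
move=> exy; apply/setP=> z; rewrite in_imset_tperm.
by case: tpermP => [->|->|].
Qed.

Lemma imset_tperm_swap (T : finType) (x y : T) (J : {set T}) :
  x \notin J -> y \notin J -> tperm x y @: (x |: J) = y |: J.
Proof.
move=> xJ yJ; rewrite imsetU1 tpermL imset_tperm_fix //.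
by rewrite (negPf xJ) (negPf yJ).
Qed.

(** A point of A outside A' can be exchanged with a point of A' outside A in the
    same class, which brings A closer to A'. *)
Lemma class_perm_transitive (T : finType) (I : eqType) (cl : T -> I)
    (A A' : {set T}) :
  (forall i, #|[set x in A | cl x == i]| = #|[set x in A' | cl x == i]|) ->
  exists2 h : {perm T}, (forall x, cl (h x) = cl x) & h @: A = A'.
Proof.
have [m] := ubnP #|A :\: A'|; elim: m A => // m IHm A ltAm eqAA'.
have [sAA'|] := boolP (A \subset A').
  exists 1%g => [x|]; first by rewrite perm1.
  rewrite imset_perm1; apply/eqP; rewrite eqEsubset sAA'; apply/subsetP=> x A'x.
  have /eqP/setP/(_ x) :
    [set y in A | cl y == cl x] == [set y in A' | cl y == cl x].
    rewrite eqEcard eqAA' leqnn andbT; apply/subsetP=> y; rewrite !inE.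
    by case/andP=> /(subsetP sAA')-> ->.
  by rewrite !inE A'x eqxx andbT => ->.
case/subsetPn=> v Av A'v.
have [w /andP[A'w Aw] clw] : exists2 w, (w \in A') && (w \notin A) & cl w = cl v.
  have : ~~ ([set x in A' | cl x == cl v] \subset [set x in A | cl x == cl v]).
    apply: contra A'v => sub.
    have /eqP/setP/(_ v) : [set x in A' | cl x == cl v] ==
       [set x in A | cl x == cl v] by rewrite eqEcard sub eqAA' leqnn.
    by rewrite !inE Av eqxx andbT => ->.
  case/subsetPn=> w; rewrite !inE => /andP[A'w /eqP clw].
  by rewrite clw eqxx andbT => Aw; exists w; rewrite ?A'w.
have clt x : cl (tperm v w x) = cl x by case: tpermP => [->|->|].
have [|i|h hcl hA] := IHm (tperm v w @: A).
- rewrite -ltnS; apply: leq_trans ltAm; rewrite ltnS.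
  apply/proper_card/properP; split; last first.
    by exists v; rewrite !inE ?Av ?A'v // in_imset_tperm tpermL (negPf Aw).
  apply/subsetP=> z; rewrite !inE in_imset_tperm.
  by case: tpermP => [->|->|_ _ //]; rewrite ?(negPf Aw) ?A'w ?andbF.
- rewrite -eqAA' -(card_imset_perm (tperm v w) [set x in A | _]).
  apply: eq_card => z.
  by rewrite inE !in_imset_tperm inE clt.
exists (tperm v w * h)%g => [x|]; first by rewrite permM hcl clt.
by rewrite imset_permM.
Qed.

Lemma card_perm_transitive (T : finType) (A A' : {set T}) :
  #|A| = #|A'| -> exists h : {perm T}, h @: A = A'.
Proof.
move=> eqA; have [|h _ hA] := @class_perm_transitive T _ (fun=> tt) A A'.
  move=> []; have tr (D : {set T}) : [set x in D | tt == tt] = D.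
    by apply/setP=> y; rewrite inE andbT.
  by rewrite !tr.
by exists h.
Qed.

Section Symmetrization.

Variables (F : numFieldType) (T : finType) (B S : {set T}).
Variable x : {set T} -> F.

(** Up to normalization, this is the average of x over the stabilizer of S,
    transported so that B takes the place of S. It depends on A only through its
    position relative to B. *)
Definition symmetrize (A : {set T}) : F :=
  \sum_(h : {perm T} | h @: B == S) x (h @: A).

Lemma symmetrize_inv (u : {perm T}) (A : {set T}) :
  u @: B = B -> symmetrize (u @: A) = symmetrize A.
Proof.
move=> uB; have uVB : u^-1%g @: B = B.
  by apply/eqP; rewrite eq_sym -imset_permV_eq uB.
rewrite /symmetrize (reindex_inj (mulgI u^-1)%g) /=.
apply: eq_big => h; rewrite imset_permM.
  by rewrite uVB.
by move=> _; rewrite -!imset_permM mulKVg.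
Qed.

Lemma symmetrize_id :
  #|B| = #|S| -> symmetrize B = 0 -> x S = 0.
Proof.
move=> /card_perm_transitive[g gB]; rewrite /symmetrize.
under eq_bigr => h /eqP-> do [].
rewrite sumr_const => /eqP; rewrite mulrn_eq0 => /orP[|/eqP//].
by move/eqP/card0_eq/(_ g); rewrite -[_ \in _]/(g @: B == S) gB eqxx.
Qed.

Lemma symmetrize_addI (J : {set T}) v w : v \notin J -> w \notin J ->
  (v \in B) = (w \in B) -> symmetrize (v |: J) = symmetrize (w |: J).
Proof.
move=> vJ wJ evw; rewrite -(imset_tperm_swap vJ wJ) symmetrize_inv //.
exact: imset_tperm_fix.
Qed.

End Symmetrization.

Section Harmonic.

Variables (F : numFieldType) (T : finType) (B : {set T}) (c : T -> nat).
Hypotheses (c_inj1 : {in B &, injective c}) (c_inj2 : {in ~: B &, injective c}).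

(** The functions on k-subsets in the kernel of the map to (k-1)-subsets; only
    the values of x at subsets with k elements matter. *)
Definition harmonic k (x : {set T} -> F) :=
  forall J : {set T}, #|J|.+1 = k -> \sum_(v in ~: J) x (v |: J) = 0.

Lemma symmetrize_harmonic k S x : harmonic k x -> harmonic k (symmetrize B S x).
Proof.
move=> dx J cJ; rewrite exchange_big /= big1 // => h _.
rewrite -[RHS](dx (h @: J)) ?card_imset_perm //.
rewrite [RHS](reindex_inj (@perm_inj _ h)) /=; apply: eq_big => v.
  by rewrite !inE mem_imset_perm.
by rewrite imsetU1.
Qed.

(** In the harmonicity relation at J, the terms with v in B all agree, and so do
    the terms with v outside B. Two nonnegative multiples thus add up to 0, so
    the two values have opposite signs. *)
Lemma exchange_sign S x (J : {set T}) v w : harmonic #|B| x -> #|J|.+1 = #|B| ->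
  v \in B -> v \notin J -> w \notin B -> w \notin J ->
  exists2 r : F, 0 <= r &
    symmetrize B S x (w |: J) = - (r * symmetrize B S x (v |: J)).
Proof.
move=> dx cJ vB vJ wB wJ; set Z := symmetrize B S x.
have := symmetrize_harmonic S dx cJ; rewrite (bigID (mem B)) /=.
rewrite (eq_bigr (fun=> Z (v |: J))) => [|u /andP[]]; last first.
  by rewrite inE => uJ uB; apply: symmetrize_addI; rewrite ?uB ?vB.
rewrite addrC (eq_bigr (fun=> Z (w |: J))) => [|u /andP[]]; last first.
  by rewrite inE => uJ /negPf uB; apply: symmetrize_addI; rewrite ?uB ?(negPf wB).
rewrite !sumr_const; set a := #|_|; set b := #|_| => /eqP.
rewrite addr_eq0 => /eqP Zab.
have a0 : a%:R != 0 :> F.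
  rewrite pnatr_eq0 -lt0n; apply/card_gt0P; exists w.
  by rewrite -[_ \in _]/((w \in ~: J) && (w \notin B)) inE wJ.
exists (b%:R / a%:R); first by rewrite divr_ge0 ?ler0n.
apply: (mulfI a0); rewrite mulrN mulrA mulrCA mulfV // mulr1.
by rewrite !mulr_natl.
Qed.

(** Columns are the fibres of c. The set B is the second row of a two-row
    tableau: each column has at most one point in B and one outside B. *)
Definition column_perm : {set {perm T}} :=
  [set q : {perm T} | [forall i, c (q i) == c i]].

Lemma column_perm_tperm v w : c v = c w -> tperm v w \in column_perm.
Proof. by move=> e; rewrite inE; apply/forallP=> i; case: tpermP => [->|->|]; rewrite ?e. Qed.

Lemma column_permM p q :
  p \in column_perm -> q \in column_perm -> (p * q)%g \in column_perm.
Proof.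
rewrite !inE => /forallP p1 /forallP q1; apply/forallP=> i.
by rewrite permM (eqP (q1 _)).
Qed.

(** A column permutation is a product of disjoint column transpositions. Each of
    them exchanges a point of B with a point outside B, so that the sign from
    [exchange_sign] cancels the sign of the transposition. *)
Lemma column_perm_sign S x q : harmonic #|B| x -> q \in column_perm ->
  exists2 r : F, 0 <= r &
    (-1) ^+ odd_perm q * symmetrize B S x (q @: B) = r * symmetrize B S x B.
Proof.
move=> dx; set Z := symmetrize B S x.
have [m] := ubnP #|[set y | q y != y]|; elim: m q => // m IHm q ltqm qc.
have [/eqP q0|[y]] := set_0Vmem [set y | q y != y].
  have -> : q = 1%g.
    apply/permP=> y; move/eqP/setP/(_ y): q0.
    by rewrite perm1 !inE => /negbFE/eqP.
  by exists 1; rewrite ?ler01 // odd_perm1 imset_perm1 expr0.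
rewrite inE => qy; move: (qc); rewrite inE => /forallP/= qcP.
have side u v : u != v -> c u = c v -> (u \in B) = (v \notin B).
  move=> nuv cuv; have [uB|uB] := boolP (u \in B); have [vB|vB] := boolP (v \in B) => //.
    by case/eqP: nuv; apply: c_inj1.
  by case/eqP: nuv; apply: c_inj2; rewrite ?inE.
have qqy : q (q y) = y.
  apply/eqP/negPn/negP => nqq.
  have n2 : q (q y) != q y by rewrite (inj_eq perm_inj).
  have c1 : c (q y) = c y by apply/eqP.
  have c2 : c (q (q y)) = c (q y) by apply/eqP.
  have := side _ _ nqq; rewrite c2 => /(_ c1).
  by rewrite (side _ _ n2 c2) (side _ _ qy c1); case: (y \in B).
pose t := tperm y (q y).
have q'y : (q * t)%g y = y by rewrite permM tpermR.
have q'q : (q * t)%g (q y) = q y by rewrite permM qqy tpermL.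
have q'c : (q * t)%g \in column_perm.
  by rewrite column_permM // column_perm_tperm // (eqP (qcP y)).
have [|r r0 IHr] := IHm _ _ q'c.
  rewrite -ltnS; apply: leq_trans ltqm; rewrite ltnS.
  apply/proper_card/properP; split; last by exists y; rewrite !inE ?q'y ?eqxx.
  apply/subsetP=> z; rewrite !inE permM; apply: contraNneq => qz.
  rewrite qz; apply/eqP/tpermD.
    by apply: contraNneq qy => yz; rewrite yz qz.
  by apply: contraNneq qy => qyz; rewrite -{2}qqy qyz qz.
(* In the column {y, q y}, the point v is the one in B. *)
have [v [w [vB wB tE q'v q'w]]] : exists v w, [/\ v \in B, w \notin B, t = tperm v w,
   (q * t)%g v = v & (q * t)%g w = w].
  have qB := side _ _ qy (eqP (qcP y)); have [yB|yB] := boolP (y \in B).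
    by exists y, (q y); rewrite qB yB.
  by exists (q y), y; rewrite qB yB tpermC.
set q' := (q * t)%g in q'v q'w IHr.
have qE : q = (q' * t)%g by rewrite /q' -mulgA tperm2 mulg1.
pose J := q' @: B :\ v.
have q'B : q' @: B = v |: J by rewrite setD1K // -q'v mem_imset_perm.
have wq' : w \notin q' @: B by rewrite -q'w mem_imset_perm.
have vJ : v \notin J by rewrite !inE eqxx.
have wJ : w \notin J by apply: contra wq'; rewrite inE => /andP[].
have qB : q @: B = w |: J.
  by rewrite {1}qE imset_permM q'B tE imset_tperm_swap.
have cJ : #|J|.+1 = #|B|.
  by rewrite -(card_imset_perm q' B) q'B cardsU1 vJ.
have [s s0] := exchange_sign S dx cJ vB vJ wB wJ; rewrite -/Z => es.
have nvw : v != w by apply: contraNneq wB => <-.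
exists (s * r); first exact: mulr_ge0.
rewrite -mulrA -IHr qB es {1}qE odd_permM tE odd_tperm nvw q'B.
by rewrite signr_addb expr1 mulrN1 mulNr mulrN opprK mulrCA.
Qed.

(** Orthogonality to the polytabloids, averaged, says that a sum over the column
    group vanishes. By [column_perm_sign] all its terms are nonnegative
    multiples of the value at B, and the identity contributes this value
    itself. *)
Theorem harmonic_orthogonal_eq0 x : harmonic #|B| x ->
  (forall h : {perm T},
    \sum_(q in column_perm) (-1) ^+ odd_perm q * x (h @: (q @: B)) = 0) ->
  forall S : {set T}, #|S| = #|B| -> x S = 0.
Proof.
move=> dx orth S cS; apply: (@symmetrize_id _ _ B) => //.
set Z := symmetrize B S x; apply/eqP/negPn/negP => ZB.
have : \sum_(q in column_perm) (-1) ^+ odd_perm q * Z (q @: B) / Z B = 0.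
  rewrite -mulr_suml (_ : \sum_(q in _) _ = 0) ?mul0r //.
  under eq_bigr do rewrite mulr_sumr.
  rewrite exchange_big big1 //= => h _; exact: orth.
have pos q : q \in column_perm -> 0 <= (-1) ^+ odd_perm q * Z (q @: B) / Z B.
  by move=> /(column_perm_sign S dx)[r r0 ->]; rewrite mulfK.
move/(psumr_eq0P pos)/(_ 1%g).
rewrite odd_perm1 imset_perm1 expr0 mul1r mulfV // => /(_ _)/eqP.
rewrite oner_eq0 => H; apply/notF/H.
by rewrite inE; apply/forallP=> i; rewrite perm1.
Qed.

(** The coefficient at J of the image of a polytabloid under the map to
    (k-1)-subsets. As J has fewer points than B, it misses some column {b, w};
    multiplication by the transposition of b and w preserves the condition on q
    and changes the sign. *)
Theorem signed_column_sum_eq0 (J : {set T}) : #|J|.+1 = #|B| ->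
  {in B, forall b, exists2 w, w \notin B & c w = c b} ->
  \sum_(q in column_perm) (-1) ^+ odd_perm q * (J \subset q @: B)%:R = 0 :> F.
Proof.
move=> cJ mate.
have [b bB cbJ] : exists2 b, b \in B & c b \notin [seq c j | j in J].
  apply/exists_inP; apply: contraLR (leqnn #|J|) => /exists_inPn noB.
  rewrite -ltnNge cJ -(size_image c) [X in (_ <= X)%N]cardE -(size_map c).
  apply: uniq_leq_size => [|n /imageP[b bB ->]]; last exact/negPn/noB.
  by rewrite map_inj_in_uniq ?enum_uniq // => u v; rewrite !mem_enum; apply: c_inj1.
have [w wB cw] := mate b bB; set t := tperm b w.
have nJ v : c v = c b -> v \notin J.
  by move=> cv; apply: contra cbJ => vJ; rewrite -cv; apply: image_f.
have tJ : t @: J = J by rewrite imset_tperm_fix // !(negPf (nJ _ _)).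
have tc : t \in column_perm by apply: column_perm_tperm.
have nbw : b != w by apply: contraNneq wB => <-.
set s := LHS; suffices : s = - s.
  by move/eqP; rewrite -addr_eq0 -mulr2n mulrn_eq0 => /eqP.
rewrite /s {1}(reindex_inj (mulIg t)) /= -sumrN; apply: eq_big => q.
  apply/idP/idP => [qt|qc]; last exact: column_permM.
  by rewrite -[q](mulgK t) tpermV column_permM.
move=> _; rewrite odd_permM odd_tperm nbw signr_addb expr1 mulrN1 mulNr.
congr (- (_ * _%:R)); congr nat_of_bool.
rewrite imset_permM -{1}tJ; apply/subsetP/subsetP => sub z zJ.
  by have := sub (t z); rewrite !mem_imset_perm; apply.
by rewrite -(tpermK b w z) mem_imset_perm; apply: sub;
  rewrite -(mem_imset_perm t) tpermK.
Qed.

End Harmonic.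

Section Up.

Variables (F : numFieldType) (T : finType).

(** Injectivity of the transpose of the map to k-subsets. After averaging over
    the stabilizer of B, the proof is by induction on the size of the
    intersection of A and B: in the relation at the set obtained by adding to A
    a point w outside A and B, removing a point of B gives a smaller
    intersection, and removing any other point gives the same value as A. *)
Theorem up_injective k (z : {set T} -> F) : (2 * k < #|T|)%N ->
  (forall S : {set T}, #|S| = k.+1 -> \sum_(v in S) z (S :\ v) = 0) ->
  forall A : {set T}, #|A| = k -> z A = 0.
Proof.
move=> ltkT zup B cB; apply: (@symmetrize_id _ _ B) => //.
set Z := symmetrize B B z.
suffices Z0 (A : {set T}) : #|A| = k -> Z A = 0 by apply: Z0.
have [m] := ubnP #|A :&: B|; elim: m A => // m IHm A ltAm cA.
have [w] : exists w, w \notin A :|: B.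
  suffices /card_gt0P[w wAB] : (0 < #|~: (A :|: B)|)%N.
    by exists w; move: wAB; rewrite inE.
  rewrite -(ltn_add2l #|A :|: B|) addn0 cardsC; apply: leq_ltn_trans ltkT.
  by rewrite mul2n -addnn -{1}cA -cB cardsU leq_subr.
rewrite !inE negb_or => /andP[wA wB].
have cS : #|w |: A| = k.+1 by rewrite cardsU1 wA cA.
have : \sum_(v in w |: A) Z ((w |: A) :\ v) = 0.
  rewrite exchange_big big1 //= => h _.
  rewrite -[RHS](zup (h @: (w |: A))) ?card_imset_perm //.
  rewrite [RHS](reindex_inj (@perm_inj _ h)) /=; apply: eq_big => v.
    by rewrite mem_imset_perm.
  by rewrite imset_permD1.
rewrite (bigID (mem B)) /= big1 ?add0r => [|v /andP[vS vB]]; last first.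
  apply: IHm; last by move: (cardsD1 v (w |: A)); rewrite vS cS => -[].
  rewrite -ltnS; apply: leq_trans ltAm; rewrite ltnS.
  apply/proper_card/properP; split.
    apply/subsetP=> u; rewrite !inE => /andP[/andP[_ /orP[/eqP->|->//]]].
    by rewrite (negPf wB).
  exists v; rewrite !inE ?eqxx // vB andbT; move: vS; rewrite !inE.
  by case/orP=> // /eqP evw; rewrite evw (negPf wB) in vB.
rewrite (eq_bigr (fun=> Z A)) => [|v /andP[vS vB]]; last first.
  have eA : tperm v w @: ((w |: A) :\ v) = A.
    rewrite imset_permD1 tpermL imset_tperm_fix ?setU1K //.
    by rewrite vS !inE eqxx.
  rewrite -[in RHS]eA [RHS]symmetrize_inv // imset_tperm_fix //.
  by rewrite (negPf vB) (negPf wB).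
rewrite sumr_const => /eqP; rewrite mulrn_eq0 => /orP[|/eqP//].
move/eqP/card0_eq/(_ w).
by rewrite -[_ \in _]/((w \in w |: A) && (w \notin B)) !inE eqxx wB.
Qed.

End Up.

(** * An exact sequence of modules on k-subsets *)

(** Additivity of the trace on the exact sequence 0 -> U -> F^n -> F^d' -> 0:
    a right inverse of U and a left inverse of W can be chosen such that the
    two associated projections add up to the identity. *)
Lemma mxtrace_exact (F : fieldType) d n d' (U : 'M[F]_(d, n)) (W : 'M_(n, d'))
    (A : 'M_n) (A1 : 'M_d) (A2 : 'M_d') :
  row_free U -> row_full W -> U *m W = 0 -> (kermx W <= U)%MS ->
  A1 *m U = U *m A -> A *m W = W *m A2 -> \tr A = \tr A1 + \tr A2.
Proof.
move=> freeU fullW UW kerW AU AW.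
have W'W : pinvmx W *m W = 1%:M by apply: mulVpmx.
set W' := pinvmx W in W'W.
have /submxP[U' defU'] : (1%:M - W *m W' <= U)%MS.
  apply: submx_trans kerW; apply/sub_kermxP.
  by rewrite mulmxBl mul1mx -mulmxA W'W mulmx1 subrr.
have UU' : U *m U' = 1%:M.
  apply: (row_free_inj freeU); rewrite /= -mulmxA -defU' mul1mx.
  by rewrite mulmxBr mulmx1 mulmxA UW mul0mx subr0.
have {1}-> : A = A *m (U' *m U) + A *m (W *m W').
  by rewrite -mulmxDr -defU' subrK mulmx1.
rewrite mxtraceD; congr (_ + _).
  by rewrite mulmxA mxtrace_mulC mulmxA -AU -mulmxA UU' mulmx1.
by rewrite mulmxA AW -mulmxA mxtrace_mulC -mulmxA W'W mulmx1.
Qed.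

Section SubsetModules.

Variables (F : fieldType) (T : finType).
Implicit Types (A J S : {set T}) (g : {perm T}).

Definition ksets k : {set {set T}} := [set A : {set T} | #|A| == k].

Definition kset_perm_mx k g : 'M[F]_#|ksets k| :=
  \matrix_(i < #|ksets k|, j < #|ksets k|) (g @: enum_val i == enum_val j)%:R.

Definition kset_down_mx k : 'M[F]_(#|ksets k.+1|, #|ksets k|) :=
  \matrix_(i < #|ksets k.+1|, j < #|ksets k|) (enum_val j \subset enum_val i)%:R.

Definition fixed_ksets k g : nat := #|[set A in ksets k | g @: A == A]|.

Lemma card_kset k (i : 'I_#|ksets k|) : #|enum_val i| = k.
Proof. by have := enum_valP i; rewrite inE => /eqP. Qed.

Lemma sum_ksetsE k (f : {set T} -> F) :
  \sum_(i < #|ksets k|) f (enum_val i) = \sum_(A in ksets k) f A.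
Proof. exact: esym (big_enum_val _). Qed.

Lemma sum_ksets_delta k A (f : {set T} -> F) : #|A| = k ->
  \sum_(i < #|ksets k|) (A == enum_val i)%:R * f (enum_val i) = f A.
Proof.
move=> cA; rewrite (sum_ksetsE k (fun S => (A == S)%:R * f S)).
rewrite (bigD1 A) /= ?inE ?cA // eqxx mul1r big1 ?addr0 // => S /andP[_ nSA].
by rewrite eq_sym (negPf nSA) mul0r.
Qed.

Lemma fixed_ksetsE k g :
  fixed_ksets k g = (\sum_(A in ksets k) (g @: A == A))%N.
Proof.
rewrite /fixed_ksets -sum1_card big_mkcond [RHS]big_mkcond.
by apply: eq_bigr => A _; rewrite !inE; case: (_ == k); case: (_ == A).
Qed.

Lemma mxtrace_kset_perm k g : \tr (kset_perm_mx k g) = (fixed_ksets k g)%:R.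
Proof.
rewrite /mxtrace; under eq_bigr do rewrite mxE.
rewrite (sum_ksetsE k (fun A => (g @: A == A)%:R)) -natr_sum.
by rewrite fixed_ksetsE.
Qed.

Lemma kset_down_perm k g :
  kset_perm_mx k.+1 g *m kset_down_mx k = kset_down_mx k *m kset_perm_mx k g.
Proof.
apply/matrixP=> i j; rewrite !mxE.
under eq_bigr do rewrite !mxE.
rewrite (sum_ksets_delta (fun S => (enum_val j \subset S)%:R)); last first.
  by rewrite card_imset_perm card_kset.
under [RHS]eq_bigr do rewrite !mxE imset_permV_eq eq_sym mulrC.
rewrite (sum_ksets_delta (fun S => (S \subset enum_val i)%:R)); last first.
  by rewrite card_imset_perm card_kset.
congr (_%:R); congr nat_of_bool.
apply/subsetP/subsetP => sub z zj.
  rewrite -(mem_imset_perm g); apply: sub.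
  by rewrite -(mem_imset_perm g^-1%g) permK.
by rewrite -(permKV g z) mem_imset_perm sub // mem_imset_perm.
Qed.

(** Reading of a row vector as a function on all subsets, zero at those of the
    wrong size. *)
Definition kset_fun k (y : 'rV[F]_#|ksets k|) A : F :=
  \sum_(i < #|ksets k|) (A == enum_val i)%:R * y 0 i.

Lemma kset_funE k (y : 'rV[F]_#|ksets k|) i : kset_fun y (enum_val i) = y 0 i.
Proof.
rewrite /kset_fun (bigD1 i) //= eqxx mul1r big1 ?addr0 // => j nji.
by rewrite (inj_eq enum_val_inj) eq_sym (negPf nji) mul0r.
Qed.

Lemma sum_kset_fun k (y : 'rV[F]_#|ksets k|) (f : {set T} -> F) :
  \sum_i y 0 i * f (enum_val i) = \sum_(A in ksets k) kset_fun y A * f A.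
Proof.
rewrite -(sum_ksetsE k (fun A => kset_fun y A * f A)).
by apply: eq_bigr => i _; rewrite kset_funE.
Qed.

End SubsetModules.

Lemma sum_ksets_sub (F : fieldType) (T : finType) k (S : {set T})
    (f : {set T} -> F) : #|S| = k.+1 ->
  \sum_(A in ksets T k) f A * (A \subset S)%:R = \sum_(v in S) f (S :\ v).
Proof.
move=> cS; have inj : {in S &, injective (fun v => S :\ v)}.
  move=> u v uS vS /setP/(_ u); rewrite !inE eqxx uS /=.
  by rewrite andbT => /esym/negbFE/eqP.
rewrite -(big_imset f inj) /= [LHS]big_mkcond [RHS]big_mkcond /=.
apply: eq_bigr => A _; rewrite inE; case: imsetP => [[v vS ->]|noA].
  have := cardsD1 v S; rewrite vS cS add1n => -[<-]; rewrite eqxx.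
  by rewrite subD1set mulr1.
case: eqP => // cA; have [sAS|] := boolP (A \subset S); last by rewrite mulr0.
case: noA; have : #|S :\: A| == 1%N.
  by rewrite cardsD (setIidPr sAS) cS cA subSnn.
case/cards1P=> v SA; exists v; first by have := set11 v; rewrite -SA inE => /andP[].
by rewrite -SA setDDr setDv set0U (setIidPr sAS).
Qed.

Lemma sum_ksets_sup (F : fieldType) (T : finType) k (J : {set T})
    (f : {set T} -> F) : #|J| = k ->
  \sum_(A in ksets T k.+1) f A * (J \subset A)%:R = \sum_(v in ~: J) f (v |: J).
Proof.
move=> cJ; have inj : {in ~: J &, injective (fun v => v |: J)}.
  move=> u v; rewrite !inE => uJ vJ /setP/(_ u).
  by rewrite !inE eqxx (negPf uJ) !orbF => /esym/eqP.
rewrite -(big_imset f inj) /= [LHS]big_mkcond [RHS]big_mkcond /=.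
apply: eq_bigr => A _; rewrite inE; case: imsetP => [[v vJ ->]|noA].
  by move: vJ; rewrite inE cardsU1 cJ => ->; rewrite eqxx subsetUr mulr1.
case: eqP => // cA; have [sJA|] := boolP (J \subset A); last by rewrite mulr0.
case: noA; have : #|A :\: J| == 1%N.
  by rewrite cardsD (setIidPr sJA) cJ cA subSnn.
case/cards1P=> v AJ; exists v; first by have := set11 v; rewrite -AJ !inE => /andP[].
by apply/setP=> z; rewrite -AJ !inE;
  have := subsetP sJA z; case: (z \in J) => [->//|_]; rewrite orbF.
Qed.

(** The sums in [up_injective] are the entries of a row vector multiplied by the
    transposed matrix, whose rows are therefore independent. *)
Lemma kset_down_full (F : numFieldType) (T : finType) k :
  (2 * k < #|T|)%N -> row_full (kset_down_mx F T k).
Proof.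
move=> ltkT; rewrite -col_leq_rank -mxrank_tr; set D := _^T.
suffices : row_free D by rewrite row_leq_rank.
rewrite -kermx_eq0; apply/eqP/row_matrixP=> r; rewrite row0.
set z := row r _; have zD : z *m D = 0.
  by apply/sub_kermxP; rewrite row_sub.
apply/rowP=> j; rewrite [RHS]mxE -kset_funE.
apply: (up_injective ltkT); last exact: card_kset.
move=> S cS; have Sk : S \in ksets T k.+1 by rewrite inE cS.
rewrite -(sum_ksets_sub _ cS) -sum_kset_fun.
have /rowP/(_ (enum_rank_in Sk S)) := zD; rewrite !mxE => zDS.
by rewrite -[RHS]zDS; apply: eq_bigr => i _; rewrite !mxE enum_rankK_in.
Qed.

Lemma kset_fun_harmonic (F : numFieldType) (T : finType) k (y : 'rV[F]_#|ksets T k.+1|) :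
  y *m kset_down_mx F T k = 0 -> harmonic k.+1 (kset_fun y).
Proof.
move=> yD J [cJ]; have Jk : J \in ksets T k by rewrite inE cJ.
rewrite -(sum_ksets_sup _ cJ) -sum_kset_fun.
have /rowP/(_ (enum_rank_in Jk J)) := yD; rewrite !mxE => yDJ.
by rewrite -[RHS]yDJ; apply: eq_bigr => i _; rewrite !mxE enum_rankK_in.
Qed.

(** * The Specht module of a two-row shape *)

Section TwoRows.

Variables (N k : nat).
Hypothesis k_le : (2 * k.+1 <= N)%N.

Local Notation sh := [:: (N - k.+1)%N; k.+1].
Local Notation X := (ksets 'I_N k.+1).
Local Notation G := [set: 'S_N]%G.
Local Notation reg := (regular_repr algC G).
Local Notation P := (kset_perm_mx algC k.+1).
Local Notation D := (kset_down_mx algC 'I_N k).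

(** The entries of the second row of the row-by-row standard tableau of shape
    [N-k-1, k+1]. *)
Definition second_row : {set 'I_N} := [set i : 'I_N | (N - k.+1 <= i)%N].
Local Notation B := second_row.

Lemma two_row_index (i : 'I_N) : reshape_index sh i = (i \in B).
Proof.
have := ltn_ord i; rewrite inE /reshape_index /= => ltiN.
rewrite subn_eq0 ltnNge; case: leqP => //= leMi.
by rewrite (_ : _ - _ - _ = 0)%N //; lia.
Qed.

Lemma two_row_offset (i : 'I_N) :
  reshape_offset sh i = (if i \in B then i - (N - k.+1) else i)%N.
Proof.
by rewrite /reshape_offset two_row_index; case: (i \in B); rewrite /= ?addn0 ?subn0.
Qed.

Lemma card_second_row : #|B| = k.+1.
Proof.
have ltkN : (k.+1 <= N)%N by lia.
have eN : (N - k.+1 + k.+1 = N)%N by lia.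
pose f (j : 'I_k.+1) := cast_ord eN (rshift (N - k.+1) j).
have injf : injective f by move=> u v /cast_ord_inj/rshift_inj.
rewrite -[RHS]card_ord -(card_imset _ injf); apply: eq_card => i.
rewrite inE; apply/idP/imsetP => [leMi|[j _ ->]]; last by rewrite /= leq_addr.
have lti : (i - (N - k.+1) < k.+1)%N by have := ltn_ord i; lia.
by exists (Ordinal lti) => //; apply: val_inj; rewrite /= subnKC.
Qed.

Lemma row_stab_second_row p : (p \in row_stab N sh) = (p @: B == B).
Proof.
rewrite inE; apply/forallP/eqP => [pB | pB i].
  apply/setP=> i; rewrite -(permKV p i) mem_imset_perm.
  have /eqP := pB (p^-1%g i); rewrite !two_row_index permKV => /eqP.
  by case: (i \in B); case: (_ \in B).
by rewrite !two_row_index -{1}pB mem_imset_perm.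
Qed.

Local Notation c := (fun i : 'I_N => reshape_offset sh i).
Local Notation C := (col_stab N sh).

Lemma second_row_offset_inj : {in B &, injective c}.
Proof.
move=> i j iB jB; rewrite !two_row_offset iB jB => eij; apply: val_inj => /=.
by move: iB jB; rewrite !inE; lia.
Qed.

Lemma first_row_offset_inj : {in ~: B &, injective c}.
Proof.
move=> i j; rewrite !in_setC => iB jB; rewrite !two_row_offset.
by rewrite (negPf iB) (negPf jB) => eij; apply: val_inj.
Qed.

(** This uses 2(k+1) <= N: the first row is at least as long as the second. *)
Lemma second_row_above : {in B, forall b, exists2 w, w \notin B & c w = c b}.
Proof.
move=> b bB; have ltb : (b - (N - k.+1) < N)%N by have := ltn_ord b; lia.
have wB : Ordinal ltb \notin B by rewrite inE /=; have := ltn_ord b; lia.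
by exists (Ordinal ltb); rewrite // !two_row_offset bB (negPf wB).
Qed.

Definition tabloid (A : {set 'I_N}) : 'rV[algC]_#|X| :=
  \row_(j < #|X|) (A == enum_val j)%:R.

Lemma tabloid_perm g (A : {set 'I_N}) : #|A| = k.+1 ->
  tabloid A *m P g = tabloid (g @: A).
Proof.
move=> cA; apply/rowP=> j; rewrite !mxE; under eq_bigr do rewrite !mxE.
exact: (sum_ksets_delta (fun S => (g @: S == enum_val j)%:R)).
Qed.

Lemma tabloid_down (A : {set 'I_N}) (j : 'I_#|ksets 'I_N k|) : #|A| = k.+1 ->
  (tabloid A *m D) 0 j = (enum_val j \subset A)%:R.
Proof.
move=> cA; rewrite !mxE; under eq_bigr do rewrite !mxE.
exact: (sum_ksets_delta (fun S => (enum_val j \subset S)%:R)).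
Qed.

Lemma card_col_second_row (q : 'S_N) : #|q @: B| = k.+1.
Proof. by rewrite card_imset_perm card_second_row. Qed.

Definition polytabloid : 'rV[algC]_#|X| :=
  \sum_(q in C) (-1) ^+ odd_perm q *: tabloid (q @: B).

Lemma polytabloid_perm g :
  polytabloid *m P g = \sum_(q in C) (-1) ^+ odd_perm q *: tabloid (g @: (q @: B)).
Proof.
rewrite mulmx_suml; apply: eq_bigr => q _.
by rewrite -scalemxAl tabloid_perm // card_col_second_row.
Qed.

Lemma polytabloid_down : polytabloid *m D = 0.
Proof.
apply/rowP=> j; rewrite [RHS]mxE mulmx_suml summxE.
rewrite -[RHS](signed_column_sum_eq0 algC second_row_offset_inj
  (J := enum_val j)) ?card_kset ?card_second_row //; last exact: second_row_above.
apply: eq_bigr => q _; rewrite -scalemxAl mxE tabloid_down //.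
exact: card_col_second_row.
Qed.

Lemma kset_down_orthogonal_polytabloids (y : 'rV[algC]_#|X|) : y *m D = 0 ->
  (forall g, y *m (polytabloid *m P g)^T = 0) -> y = 0.
Proof.
move=> /kset_fun_harmonic yD orth; apply/rowP=> j; rewrite [RHS]mxE -kset_funE.
apply: (harmonic_orthogonal_eq0 second_row_offset_inj first_row_offset_inj).
- by rewrite card_second_row.
- move=> h; have /rowP/(_ 0) := orth h; rewrite [RHS]mxE => e0; rewrite -[RHS]e0.
  rewrite polytabloid_perm linear_sum mulmx_sumr summxE.
  apply: eq_bigr => q _; rewrite linearZ /= -scalemxAr mxE; congr (_ * _).
  by rewrite mxE; apply: eq_bigr => i _; rewrite !mxE mulrC.
by rewrite card_kset card_second_row.
Qed.

(** The module map from the regular representation to the permutation module on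
    (k+1)-subsets that sends g to the image of the second row. *)
Definition tabloid_mx : 'M[algC]_(#|G|, #|X|) :=
  \matrix_(i < #|G|) tabloid (enum_val i @: B).
Local Notation Q := tabloid_mx.

Lemma row_tabloid_mx g : row (gring_index G g) Q = tabloid (g @: B).
Proof. by rewrite rowK gring_indexK ?inE. Qed.

Lemma regular_tabloid_mx g : reg g *m Q = Q *m P g.
Proof.
apply/row_matrixP=> i; rewrite !row_mul rowK -rowE row_tabloid_mx rowK.
by rewrite tabloid_perm ?card_col_second_row // imset_permM.
Qed.

Lemma tr_regular_mx g : (reg g)^T = reg g^-1%g.
Proof.
apply/matrixP=> i j; rewrite !mxE eqxx /=; congr (_%:R); congr nat_of_bool.
rewrite -!(inj_eq enum_val_inj) !gring_indexK ?inE //.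
by apply/eqP/eqP => ->; rewrite ?mulgK ?mulgKV.
Qed.

Lemma tr_kset_perm_mx g : (P g : 'M_#|X|)^T = P g^-1%g.
Proof.
by apply/matrixP=> i j; rewrite !mxE imset_permV_eq eq_sym.
Qed.

Lemma tr_tabloid_mx_regular g : Q^T *m reg g = P g *m Q^T.
Proof.
rewrite -[g]invgK -tr_regular_mx -tr_kset_perm_mx -!trmx_mul.
by rewrite regular_tabloid_mx.
Qed.

(** Each fibre of the map from permutations to subsets is a coset of the row
    stabilizer; hence the transpose is an inverse of [tabloid_mx] on the Specht
    module, up to the nonzero factor #|row_stab|. *)
Lemma tabloid_mx_gram : Q^T *m Q = #|row_stab N sh|%:R%:M.
Proof.
apply/matrixP=> i j; rewrite !mxE; under eq_bigr do rewrite !mxE.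
pose f (g : 'S_N) : algC := (g @: B == enum_val i)%:R * (g @: B == enum_val j)%:R.
transitivity (\sum_(g in G) f g); first exact: esym (big_enum_val _).
rewrite /f {f}.
have [<-|nij] := eqVneq i j; last first.
  rewrite big1 // => g _; case: eqP => [->|]; last by rewrite mul0r.
  by rewrite (inj_eq enum_val_inj) (negPf nij) mulr0.
have [h hB] : exists h : 'S_N, h @: B = enum_val i.
  by apply: card_perm_transitive; rewrite card_second_row card_kset.
rewrite (reindex_inj (mulIg h)) /= mulr1n -sum1_card natr_sum.
rewrite [LHS]big_mkcond [RHS]big_mkcond /=; apply: eq_bigr => g _.
rewrite row_stab_second_row !inE imset_permM -hB imset_perm_inj.
by case: eqP; rewrite ?mulr1 ?mulr0.
Qed.

Lemma card_row_stab_neq0 : #|row_stab N sh|%:R != 0 :> algC.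
Proof.
rewrite pnatr_eq0 -lt0n; apply/card_gt0P; exists 1%g.
by rewrite row_stab_second_row imset_perm1.
Qed.

(** The row sum in the symmetrizer makes it constant on the fibres of the map
    from permutations to subsets. *)
Lemma young_symmetrizerE : young_symmetrizer N sh = polytabloid *m Q^T.
Proof.
rewrite /young_symmetrizer exchange_big mulmx_suml /=; apply: eq_bigr => q _.
rewrite -scaler_sumr -scalemxAl; congr (_ *: _); apply/rowP=> i.
set g := enum_val i; rewrite summxE [RHS]mxE.
under [RHS]eq_bigr do rewrite !mxE.
rewrite (sum_ksets_delta (fun S => (g @: B == S)%:R)) ?card_col_second_row //.
under eq_bigr => p _.
  rewrite mxE eqxx /= -(inj_eq enum_val_inj) gring_indexK ?inE // -/g.
  rewrite -(inj_eq (mulIg q^-1%g)) mulgK eq_sym.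
  over.
have -> : (g @: B == q @: B) = ((g * q^-1)%g \in row_stab N sh).
  by rewrite row_stab_second_row imset_permM imset_permV_eq invgK.
rewrite -natr_sum; case: (boolP (_ \in _)) => [Rgq|nR].
  by rewrite (bigD1 (g * q^-1)%g) //= eqxx big1 ?addn0 // => p /andP[_ /negPf->].
by rewrite big1 // => p Rp; case: eqP Rp nR => // -> ->.
Qed.

Local Notation V := (cyclic_mx reg (young_symmetrizer N sh)).
Local Notation modV := (cyclic_mx_module reg (young_symmetrizer N sh)).
Local Notation U := (val_submod (1%:M : 'M_(\rank V)) *m Q).

Lemma cyclic_tabloid_mx : (V <= Q^T)%MS.
Proof.
apply: cyclic_mx_sub; last by rewrite young_symmetrizerE submxMl.
by apply/mxmoduleP=> g _; rewrite tr_tabloid_mx_regular submxMl.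
Qed.

Lemma cyclic_tabloid_down : (V <= kermx (Q *m D))%MS.
Proof.
apply: cyclic_mx_sub.
  apply/mxmoduleP=> g _; apply/sub_kermxP.
  rewrite -mulmxA (mulmxA (reg g)) regular_tabloid_mx -(mulmxA Q).
  by rewrite kset_down_perm !mulmxA -(mulmxA _ Q) mulmx_ker mul0mx.
apply/sub_kermxP; rewrite young_symmetrizerE mulmxA -(mulmxA polytabloid).
by rewrite tabloid_mx_gram mul_mx_scalar -scalemxAl polytabloid_down scaler0.
Qed.

Lemma specht_row_free : row_free U.
Proof.
have VQQ : U *m Q^T = #|row_stab N sh|%:R *: val_submod (1%:M : 'M_(\rank V)).
  have /submxP[z ->] : (val_submod (1%:M : 'M_(\rank V)) <= Q^T)%MS.
    exact: submx_trans (val_submodP _) cyclic_tabloid_mx.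
  rewrite -!mulmxA (mulmxA Q^T) tabloid_mx_gram mul_scalar_mx.
  by rewrite -scalemxAr.
rewrite -row_leq_rank; apply: leq_trans (mxrankM_maxl U Q^T).
by rewrite VQQ mxrank_scale_nz ?card_row_stab_neq0 // val_submod1.
Qed.

Lemma specht_down : U *m D = 0.
Proof.
rewrite -mulmxA; apply/sub_kermxP.
exact: submx_trans (val_submodP _) cyclic_tabloid_down.
Qed.

(** The Young symmetrizer is mapped to a nonzero multiple of the polytabloid. *)
Lemma specht_polytabloid g : (polytabloid *m P g <= U)%MS.
Proof.
have /submxP[z ez] : (young_symmetrizer N sh *m reg g <= val_submod (1%:M : 'M_(\rank V)))%MS.
  rewrite val_submod1; apply: mxmodule_trans modV _ _; rewrite ?inE //.
  exact: cyclic_mx_id.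
have -> : polytabloid *m P g = #|row_stab N sh|%:R^-1 *: (z *m U).
  rewrite mulmxA -ez -mulmxA regular_tabloid_mx young_symmetrizerE.
  rewrite mulmxA -(mulmxA polytabloid) tabloid_mx_gram mul_mx_scalar -scalemxAl.
  by rewrite scalerA mulVf ?card_row_stab_neq0 // scale1r.
by rewrite scalemx_sub // submxMl.
Qed.

(** The bilinear pairing of the kernel with the image of the Specht module has
    no kernel on the left, so the rank of the image is at least that of the
    kernel. *)
Lemma kset_down_specht : (kermx D <= U)%MS.
Proof.
have UD : (U <= kermx D)%MS by apply/sub_kermxP/specht_down.
rewrite -(mxrank_leqif_sup UD) eqn_leq mxrankS //=.
have cap0 : (kermx D :&: kermx U^T = 0)%MS.
  apply/row_matrixP=> r; rewrite row0; set y := row r _.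
  have : (y <= kermx D :&: kermx U^T)%MS by apply: row_sub.
  rewrite sub_capmx => /andP[/sub_kermxP yD /sub_kermxP yU].
  apply: kset_down_orthogonal_polytabloids yD _ => g.
  have /submxP[z ->] := specht_polytabloid g.
  by rewrite trmx_mul mulmxA yU mul0mx.
rewrite -(mxrank_mul_ker (kermx D) U^T) cap0 mxrank0 addn0.
by rewrite -(mxrank_tr U) mxrankM_maxr.
Qed.

(** Traces on the exact sequence from the Specht module to the
    (k+1)-subsets and on to the k-subsets. *)
Theorem specht_char_two_row g :
  specht_char N sh g = (fixed_ksets k.+1 g)%:R - (fixed_ksets k g)%:R.
Proof.
rewrite /specht_char /cfRepr cfunE in_setT mulr1n.
rewrite -!(mxtrace_kset_perm algC); apply/esym/eqP; rewrite subr_eq; apply/eqP.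
apply: (mxtrace_exact specht_row_free _ specht_down kset_down_specht).
- by apply: kset_down_full; rewrite card_ord; lia.
- rewrite mulmxA -val_submodE -[specht_repr N sh g]mul1mx.
  by rewrite val_submodJ ?inE // -!mulmxA regular_tabloid_mx.
- exact: kset_down_perm.
Qed.

End TwoRows.

(** * Averaging a transposition over a Young subgroup *)

Lemma fixed_ksetsJ (T : finType) k (g u : {perm T}) :
  fixed_ksets k (g ^ u)%g = fixed_ksets k g.
Proof.
rewrite !fixed_ksetsE (reindex_inj (imset_inj (@perm_inj _ u))) /=.
apply: eq_big => A; first by rewrite !inE card_imset_perm.
by move=> _; rewrite -imset_permM conjgE mulKVg imset_permM imset_perm_inj.
Qed.

Section Classes.

Local Open Scope nat_scope.

Variables (T : finType) (I : eqType) (cl : T -> I).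
Implicit Types (A J : {set T}) (i : I).

Definition class_perms : {set {perm T}} :=
  [set h : {perm T} | [forall x, cl (h x) == cl x]].
Local Notation G := class_perms.

Lemma class_permP (h : {perm T}) : reflect (forall x, cl (h x) = cl x) (h \in G).
Proof. by rewrite inE; apply: (iffP forallP) => hcl x; apply/eqP. Qed.

Lemma class_perms_group_set : group_set G.
Proof.
apply/group_setP; split=> [|g h /class_permP gcl /class_permP hcl].
  by apply/class_permP=> x; rewrite perm1.
by apply/class_permP=> x; rewrite permM hcl.
Qed.
Canonical class_perms_group := Group class_perms_group_set.

Lemma tperm_class x y : cl x = cl y -> tperm x y \in G.
Proof. by move=> e; apply/class_permP=> z; case: tpermP => [->|->|]. Qed.

Definition class_count A i := #|[set x in A | cl x == i]|.

Lemma class_countE A i : class_count A i = \sum_(x in A) (cl x == i).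
Proof.
rewrite /class_count -sum1_card big_mkcond [RHS]big_mkcond /=.
by apply: eq_bigr => x _; rewrite inE; case: (x \in A) => //=; case: eqP.
Qed.

Lemma card_class i : \sum_(x | cl x == i) 1 = class_count setT i.
Proof. by rewrite /class_count -sum1_card; apply: eq_bigl => x; rewrite !inE. Qed.

Lemma class_countU1 v J i : v \notin J ->
  class_count (v |: J) i = (cl v == i) + class_count J i.
Proof.
move=> vJ; rewrite /class_count; case: eqP => cv /=.
  have := cardsU1 v [set x in J | cl x == i]; rewrite inE (negPf vJ) /= => <-.
  apply: eq_card => x; rewrite !inE; case: eqP => [->|//].
  by rewrite cv eqxx.
rewrite add0n; apply: eq_card => x; rewrite !inE; case: eqP => [->|//] /=.
by rewrite (negPf vJ); apply/eqP.
Qed.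

Lemma class_count_perm h A i : h \in G -> class_count (h @: A) i = class_count A i.
Proof.
move=> /class_permP hcl; rewrite /class_count -(card_imset_perm h [set x in A | _]).
apply: eq_card => x; rewrite -(permKV h x) inE !mem_imset_perm inE.
by rewrite hcl.
Qed.

(** If exactly one of x, y is in A, the transposition changes the number of
    points of A in the class of x, which a class-preserving h cannot restore. *)
Lemma card_tperm_stab x y A : cl x != cl y ->
  #|[set h in G | h @: (tperm x y @: A) == A]| =
  ((x \in A) == (y \in A)) * #|[set h in G | h @: A == A]|.
Proof.
move=> ncl; case: eqP => [/imset_tperm_fix-> | /eqP nxy]; first by rewrite mul1n.
rewrite mul0n; apply: eq_card0 => h; rewrite inE; apply/negP=> /andP[Gh /eqP hA].
have := class_count_perm (tperm x y @: A) (cl x) Gh; rewrite {}hA.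
have sw v w : v \in A -> w \notin A ->
    class_count A (cl x) = class_count (tperm v w @: A) (cl x) ->
    (cl v == cl x) = (cl w == cl x).
  move=> vA wA; rewrite -(setD1K vA).
  have vJ : v \notin A :\ v by rewrite !inE eqxx.
  have wJ : w \notin A :\ v by rewrite inE (negPf wA) andbF.
  rewrite imset_tperm_swap // !class_countU1 // => /addIn.
  by do 2!case: (_ == _).
have ncl' : (cl y == cl x) = false by rewrite eq_sym (negPf ncl).
have [xA|xA] := boolP (x \in A).
  have yA : y \notin A by move: nxy; rewrite xA.
  by move=> /(sw _ _ xA yA); rewrite eqxx ncl'.
have yA : y \in A by move: nxy; rewrite (negPf xA); case: (y \in A).
by rewrite tpermC => /(sw _ _ yA xA); rewrite eqxx ncl'.
Qed.

(** The number of transpositions of a point of class i and a point of class j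
    that keep the profile of A, when i and j are distinct. *)
Lemma sum_class_agree A i j :
  \sum_(x | cl x == i) \sum_(y | cl y == j) ((x \in A) == (y \in A)) =
  class_count A i * class_count A j +
  (class_count setT i - class_count A i) * (class_count setT j - class_count A j).
Proof.
have inA i' : \sum_(y | cl y == i') (y \in A) = class_count A i'.
  rewrite /class_count -sum1_card big_mkcond [RHS]big_mkcond /=.
  by apply: eq_bigr => y _; rewrite inE; case: (_ == i'); case: (_ \in A).
have outA i' : \sum_(y | cl y == i') (y \notin A) = class_count setT i' - class_count A i'.
  rewrite -card_class -inA; apply/esym/eqP; rewrite -(eqn_add2r (\sum_(y | cl y == i') (y \in A))).
  rewrite subnK; last by apply: leq_sum => y _; case: (y \in A).
  by rewrite -big_split; apply/eqP/eq_bigr => y _; case: (y \in A).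
rewrite -!outA -!inA !big_distrl -big_split /=; apply: eq_bigr => x _.
rewrite !big_distrr -big_split /=; apply: eq_bigr => y _.
by case: (x \in A); case: (y \in A).
Qed.

(** The unnormalized average of the permutation character on k-subsets over a
    coset of the class-preserving group. *)
Definition tperm_sum k x y := \sum_(h in G) fixed_ksets k (tperm x y * h)%g.

Lemma tperm_sum_class k x y x' y' : cl x != cl y -> cl x' = cl x -> cl y' = cl y ->
  tperm_sum k x' y' = tperm_sum k x y.
Proof.
move=> ncl cx cy; set u := (tperm x x' * tperm y y')%g.
have Gu : u \in G by rewrite groupM ?tperm_class ?cx ?cy.
have neq v w : cl v != cl w -> v != w by apply: contraNneq => ->.
have ux : u x = x'.
  by rewrite permM tpermL tpermD //; apply: neq; rewrite cx ?cy eq_sym.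
have uy : u y = y'.
  rewrite permM [tperm x x' y]tpermD ?tpermL //; first exact: neq.
  by apply: neq; rewrite cx.
rewrite /tperm_sum (reindex_inj (conjg_inj u)) /=.
rewrite -{1}ux -{1}uy; apply: eq_big => h; first by rewrite groupJr.
by rewrite -tpermJ -conjMg fixed_ksetsJ.
Qed.

(** By [tperm_sum_class] the left-hand side is a sum over all pairs of points
    from the two classes; exchanging it with the sum over the subsets A leaves,
    for each A, the stabilizer of A as often as the two points agree on A. *)
Lemma tperm_sumE k x y : cl x != cl y ->
  class_count setT (cl x) * class_count setT (cl y) * tperm_sum k x y =
  \sum_(A in ksets T k)
     (class_count A (cl x) * class_count A (cl y) +
      (class_count setT (cl x) - class_count A (cl x)) *
      (class_count setT (cl y) - class_count A (cl y))) *
     #|[set h in G | h @: A == A]|.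
Proof.
move=> ncl.
transitivity (\sum_(x' | cl x' == cl x) \sum_(y' | cl y' == cl y) tperm_sum k x' y').
  rewrite -!card_class !big_distrl /=; apply: eq_bigr => x' /eqP cx.
  rewrite mul1n big_distrl /=; apply: eq_bigr => y' /eqP cy.
  by rewrite mul1n (tperm_sum_class _ ncl cx cy).
transitivity (\sum_(x' | cl x' == cl x) \sum_(y' | cl y' == cl y)
   \sum_(A in ksets T k) ((x' \in A) == (y' \in A)) * #|[set h in G | h @: A == A]|).
  apply: eq_bigr => x' /eqP cx; apply: eq_bigr => y' /eqP cy.
  rewrite /tperm_sum; under eq_bigr do rewrite fixed_ksetsE.
  rewrite exchange_big; apply: eq_bigr => A _.
  rewrite -card_tperm_stab ?cx ?cy // -sum1_card big_mkcond [RHS]big_mkcond /=.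
  apply: eq_bigr => h _; rewrite [in RHS]inE -imset_permM.
  by case: (h \in G) => //=; case: eqP.
under eq_bigr do rewrite exchange_big; rewrite exchange_big; apply: eq_bigr => A _ /=.
by rewrite -sum_class_agree big_distrl /=; apply: eq_bigr => x' _; rewrite big_distrl.
Qed.

(** The subsets satisfying Q form the orbit of A0. The stabilizer of each of them
    is as large as the set of group elements moving A0 to it, and these sets
    partition the group. *)
Lemma sum_stab_orbit (A0 : {set T}) (Q : pred {set T}) :
  (forall A, reflect (forall i, class_count A i = class_count A0 i) (Q A)) ->
  \sum_(A | Q A) #|[set h in G | h @: A == A]| = #|G|.
Proof.
move=> QP; transitivity (\sum_(A | Q A) \sum_(h in G) (h @: A0 == A)).
  apply: eq_bigr => A /QP QA.
  have [u ucl uA] := class_perm_transitive (fun i => esym (QA i)).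
  rewrite -sum1_card big_mkcond [RHS]big_mkcond /= (reindex_inj (mulgI u^-1%g)) /=.
  apply: eq_bigr => h _; have Gu : u \in G by apply/class_permP.
  rewrite inE groupMl ?groupV // -{1}uA -imset_permM mulKVg.
  by case: (h \in G) => //=; case: eqP.
rewrite exchange_big /= -sum1_card; apply: eq_bigr => h Gh.
rewrite (bigD1 (h @: A0)) /= ?eqxx; last by apply/QP=> i; rewrite class_count_perm.
by rewrite big1 ?addn0 // => A /andP[_ /negPf]; rewrite eq_sym => ->.
Qed.

Section ThreeClasses.

Variables i1 i2 i3 : I.
Hypothesis cl3 : forall x, (cl x == i1) + (cl x == i2) + (cl x == i3) = 1.
Local Notation n1 := (class_count setT i1).
Local Notation n2 := (class_count setT i2).
Local Notation n3 := (class_count setT i3).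

Lemma card_class_count A :
  #|A| = class_count A i1 + class_count A i2 + class_count A i3.
Proof.
by rewrite !class_countE -!big_split -sum1_card; apply: eq_bigr => x _; rewrite /= cl3.
Qed.

Lemma class_count_le A i : class_count A i <= class_count setT i.
Proof. by apply/subset_leq_card/subsetP=> x; rewrite !inE => /andP[_ ->]. Qed.

Lemma class_count_exists a b c : a <= n1 -> b <= n2 -> c <= n3 ->
  exists A, [/\ class_count A i1 = a, class_count A i2 = b & class_count A i3 = c].
Proof.
have sub i m : m <= class_count setT i ->
    exists A, (forall x, x \in A -> cl x = i) /\ #|A| = m.
  move=> lem; have /card_gt0P[A] :
      0 < #|[set A : {set T} | A \subset [set x in setT | cl x == i] & #|A| == m]|.
    by rewrite cards_draws bin_gt0.
  rewrite inE => /andP[/subsetP sA /eqP cA]; exists A; split=> // x /sA.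
  by rewrite !inE => /eqP.
move=> /sub[A1 [s1 c1]] /sub[A2 [s2 c2]] /sub[A3 [s3 c3]].
have s1' x : (x \in A1) ==> (cl x == i1) by apply/implyP=> /s1->.
have s2' x : (x \in A2) ==> (cl x == i2) by apply/implyP=> /s2->.
have s3' x : (x \in A3) ==> (cl x == i3) by apply/implyP=> /s3->.
exists (A1 :|: A2 :|: A3); split; rewrite -?c1 -?c2 -?c3; apply: eq_card => x;
  rewrite !inE; move: (cl3 x) (s1' x) (s2' x) (s3' x);
  case: (cl x == i1); case: (cl x == i2); case: (cl x == i3) => //;
  by case: (x \in A1); case: (x \in A2); case: (x \in A3).
Qed.

(** Every triple (a,b,c) bounded by the class sizes is the profile of some
    subset, hence contributes exactly one orbit. *)
Lemma sum_stab_profiles k (f : nat -> nat -> nat) :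
  \sum_(A in ksets T k)
     f (class_count A i1) (class_count A i2) * #|[set h in G | h @: A == A]| =
  #|G| * \sum_(a < n1.+1) \sum_(b < n2.+1) \sum_(c < n3.+1 | a + b + c == k) f a b.
Proof.
pose p A : 'I_n1.+1 * 'I_n2.+1 * 'I_n3.+1 :=
  (inord (class_count A i1), inord (class_count A i2), inord (class_count A i3)).
have pE A a b c : (p A == (a, b, c)) =
    [&& class_count A i1 == a, class_count A i2 == b & class_count A i3 == c].
  by rewrite !xpair_eqE -!val_eqE /= !inordK ?ltnS ?class_count_le // andbA.
rewrite (partition_big p predT) //=.
rewrite big_distrr /=; under [RHS]eq_bigr do rewrite big_distrr.
rewrite pair_bigA /=; under [RHS]eq_bigr do rewrite big_mkcond big_distrr.
rewrite pair_bigA /=; apply: eq_bigr => [[[a b] c]] _ /=.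
have [A0 [a0 b0 c0]] := class_count_exists (ltn_ord a) (ltn_ord b) (ltn_ord c).
case: eqP => [<-|nk]; last first.
  rewrite muln0 big1 // => A; rewrite pE inE => /andP[/eqP cA].
  case/and3P=> /eqP eA1 /eqP eA2 /eqP eA3; case: nk.
  by rewrite -eA1 -eA2 -eA3 -card_class_count.
rewrite mulnC -(@sum_stab_orbit A0 (fun A => p A == (a, b, c))) => [|A].
  rewrite big_distrr /=; apply: eq_big => A; rewrite pE inE.
    apply: andb_idl => /and3P[/eqP eA1 /eqP eA2 /eqP eA3].
    by rewrite card_class_count eA1 eA2 eA3 eqxx.
  by case/andP=> _ /and3P[/eqP-> /eqP-> _].
rewrite pE; apply: (iffP and3P) => [[/eqP eA1 /eqP eA2 /eqP eA3] i | eA].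
  have [->|n1i] := eqVneq i i1; first by rewrite eA1.
  have [->|n2i] := eqVneq i i2; first by rewrite eA2.
  have [->|n3i] := eqVneq i i3; first by rewrite eA3.
  have cl0 x : cl x != i.
    by apply/eqP=> ex; have := cl3 x; rewrite ex (negPf n1i) (negPf n2i) (negPf n3i).
  have cc0 A' : class_count A' i = 0.
    by apply: eq_card0 => x; rewrite inE (negPf (cl0 x)) andbF.
  by rewrite !cc0.
by rewrite !eA a0 b0 c0.
Qed.

Theorem tperm_sum_profiles k x y : cl x = i1 -> cl y = i2 -> i1 != i2 ->
  n1 * n2 * tperm_sum k x y =
  #|G| * \sum_(a < n1.+1) \sum_(b < n2.+1) \sum_(c < n3.+1 | a + b + c == k)
     (a * b + (n1 - a) * (n2 - b)).
Proof.
move=> cx cy n12; have := @tperm_sumE k x y; rewrite cx cy => -> //.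
by rewrite -(sum_stab_profiles k (fun a b => a * b + (n1 - a) * (n2 - b))).
Qed.

End ThreeClasses.

End Classes.

(** * Summation of the profile counts *)

Lemma sum_quadratic (F : numFieldType) (al be ga : F) l n :
  \sum_(l <= m < l + n) (al * m%:R ^+ 2 + be * m%:R + ga) =
  n%:R * (al * l%:R ^+ 2 + be * l%:R + ga) +
  (n%:R * (n%:R - 1) / 2%:R) * (2%:R * al * l%:R + be) +
  (n%:R * (n%:R - 1) * (2%:R * n%:R - 1) / 6%:R) * al.
Proof.
elim: n => [|n IHn]; first by rewrite addn0 big_geq // !mul0r !addr0.
rewrite addnS big_nat_recr ?leq_addr //= IHn natrD -natr1.
by field.
Qed.

(** The contribution of the profiles with a + b = j to [triple_sum] below, when
    the third entry that they require lies between 0 and n3. *)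
Definition pair_sum n1 n2 j : nat :=
  \sum_(a < n1.+1) \sum_(b < n2.+1 | (a + b == j)%N) (a * b + (n1 - a) * (n2 - b)).

Definition triple_sum n1 n2 n3 k : nat :=
  \sum_(a < n1.+1) \sum_(b < n2.+1) \sum_(c < n3.+1 | (a + b + c == k)%N)
     (a * b + (n1 - a) * (n2 - b)).

(** The eigenvalue of the sum of the transpositions between two blocks of sizes
    n1 and n2 on the vectors invariant under both symmetric groups in the
    irreducible representation [n1+n2-m, m]. *)
Definition eigen_term (F : fieldType) (n1 n2 m : nat) : F :=
  (m%:R - n1%:R) * (m%:R - n2%:R) - m%:R.

Lemma big_ord_eq_add s n j (x : nat) :
  (\sum_(c < n.+1 | s + c == j) x = if (s <= j) && (j <= s + n) then x else 0)%N.
Proof.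
case: ifP => [/andP[sj jn]|nj].
  have lt : (j - s < n.+1)%N by lia.
  rewrite (big_pred1 (Ordinal lt)) // => c; rewrite /= -val_eqE /=; lia.
by rewrite big_pred0 // => c; have := ltn_ord c; lia.
Qed.

(** For given a and b, the number c must satisfy 0 <= c <= n3; moving k to k+1
    shifts this window on a + b by one. *)
Lemma triple_sumS n1 n2 n3 k :
  (triple_sum n1 n2 n3 k.+1 + (if n3 <= k then pair_sum n1 n2 (k - n3) else 0) =
   triple_sum n1 n2 n3 k + pair_sum n1 n2 k.+1)%N.
Proof.
have -> : (if n3 <= k then pair_sum n1 n2 (k - n3) else 0)%N =
    \sum_(a < n1.+1) \sum_(b < n2.+1)
       (if a + b + n3 == k then a * b + (n1 - a) * (n2 - b) else 0)%N.
  case: leqP => [le|lt].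
    apply: eq_bigr => a _; rewrite big_mkcond; apply: eq_bigr => b _ /=.
    by congr (if _ then _ else _); lia.
  rewrite big1 // => a _; rewrite big1 // => b _; case: eqP => //; lia.
rewrite /triple_sum /pair_sum -!big_split; apply: eq_bigr => a _ /=.
rewrite -big_split [X in (_ = _ + X)%N]big_mkcond -big_split.
apply: eq_bigr => b _ /=; rewrite !big_ord_eq_add.
set x := (_ + _ * _)%N; move: x => x; do 6?case: ifP; lia.
Qed.

Section PairSum.

Variables (F : numFieldType) (n1 n2 : nat).

(** With b = j - a, the summand is a quadratic polynomial in a; the interval of
    admissible values of a is given by its start l and length n. *)
Lemma pair_sumE j l n : (forall a, (l <= a < l + n) = [&& a <= n1, a <= j & j <= a + n2])%N ->
  (pair_sum n1 n2 j)%:R =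
  \sum_(l <= a < l + n) ((- 2%:R) * a%:R ^+ 2 +
      (2%:R * j%:R + n1%:R - n2%:R) * a%:R + n1%:R * (n2%:R - j%:R)) :> F.
Proof.
move=> lnP; rewrite /pair_sum natr_sum.
pose f a : F := if [&& a <= n1, a <= j & j <= a + n2]%N then
 (- 2%:R) * a%:R ^+ 2 + (2%:R * j%:R + n1%:R - n2%:R) * a%:R + n1%:R * (n2%:R - j%:R) else 0.
transitivity (\sum_(a < n1.+1) f a)%R.
  apply: eq_bigr => a _; have lea : (a <= n1)%N by rewrite -ltnS.
  rewrite /f lea /=; case: ifP => [/andP[aj ja]|nj]; last first.
    by rewrite big_pred0 // => b; have := ltn_ord b; move/negbT: nj; lia.
  have lt : (j - a < n2.+1)%N by lia.
  rewrite (big_pred1 (Ordinal lt)) => [|b]; last by rewrite /= -val_eqE /=; lia.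
  rewrite /= natrD !natrM !natrB; try lia.
  ring.
rewrite -(big_mkord predT f) /=; pose M := maxn n1.+1 (l + n).
have ext u v : (u <= v)%N -> (forall a, (a < v)%N -> ~~ (l <= a < l + n)%N \/ (a < u)%N) ->
  \sum_(0 <= a < v) f a = \sum_(0 <= a < u) f a.
  move=> uv H; rewrite (big_cat_nat _ uv) //= [X in _ + X]big_nat_cond [X in _ + X]big1 ?addr0 //.
  move=> a; rewrite andbT => /andP[ua av]; rewrite /f -lnP.
  by case: (H a av) => [/negPf->//|]; rewrite ltnNge ua.
transitivity (\sum_(0 <= a < M) f a).
  apply/esym/ext; first exact: leq_maxl.
  by move=> a _; rewrite lnP; case: (leqP a n1) => le; [right|left].
rewrite (ext (l + n)%N) ?leq_maxr //; last first.
  by move=> a _; case: (ltnP a (l + n)) => le; [right|left; rewrite andbF].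
rewrite (big_cat_nat _ (leq_addr n l)) //= [X in X + _]big_nat_cond [X in X + _]big1 ?add0r.
  by rewrite big_nat_cond [RHS]big_nat_cond; apply: eq_bigr => a; rewrite andbT /f -lnP => ->.
move=> a; rewrite andbT => /andP[_ al]; rewrite /f -lnP.
by rewrite leqNgt al.
Qed.

Lemma eigen_termE m : eigen_term F n1 n2 m =
  1 * m%:R ^+ 2 + (- (n1%:R + n2%:R + 1)) * m%:R + n1%:R * n2%:R.
Proof. by rewrite /eigen_term; ring. Qed.

(** Both sides are sums of quadratic polynomials over intervals; in each of the
    four orders of j relative to n1 and n2 the closed forms agree. *)
Lemma pair_sum_eigen j : (j <= n1 + n2)%N ->
  (pair_sum n1 n2 j)%:R =
  \sum_(0 <= m < (minn (minn n1 n2) (minn j (n1 + n2 - j))).+1) eigen_term F n1 n2 m.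
Proof.
move=> jle; under [RHS]eq_bigr do rewrite eigen_termE.
have [j1|j1] := leqP j n1; have [j2|j2] := leqP j n2.
- rewrite (@pair_sumE j 0 j.+1) => [|a]; last by lia.
  rewrite (_ : minn _ _ = j); last by lia.
  rewrite -[X in \sum_(0 <= m < X) _]add0n !sum_quadratic -natr1.
  by field.
- have ej : j = (n2 + (j - n2))%N by lia.
  rewrite (@pair_sumE j (j - n2) n2.+1) => [|a]; last by lia.
  rewrite (_ : minn _ _ = n2); last by lia.
  rewrite -[X in \sum_(0 <= m < X) _]add0n !sum_quadratic -natr1 natrB; last by lia.
  by field.
- rewrite (@pair_sumE j 0 n1.+1) => [|a]; last by lia.
  rewrite (_ : minn _ _ = n1); last by lia.
  rewrite -[X in \sum_(0 <= m < X) _]add0n !sum_quadratic -natr1.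
  by field.
rewrite (@pair_sumE j (j - n2) (n1 + n2 - j).+1) => [|a]; last by lia.
rewrite (_ : minn _ _ = n1 + n2 - j)%N; last by lia.
rewrite -[X in \sum_(0 <= m < X) _]add0n !sum_quadratic -natr1 !natrB; try lia; rewrite ?natrD.
by field.
Qed.

End PairSum.

(** The two sums left by [triple_sumS] are initial segments of the same series,
    the shorter one ending just before k + 1 - n3. *)
Lemma triple_sum_eigen (F : numFieldType) n1 n2 n3 k
    (M := minn (minn n1 n2) (minn k.+1 (n1 + n2 - k.+1))) :
  (2 * k.+1 <= n1 + n2 + n3)%N -> (k.+1 <= n1 + n2)%N -> (k.+1 - n3 <= M)%N ->
  (triple_sum n1 n2 n3 k.+1)%:R - (triple_sum n1 n2 n3 k)%:R =
  \sum_(k.+1 - n3 <= m < M.+1) eigen_term F n1 n2 m.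
Proof.
move=> leN le12 leM.
have /(congr1 (fun n => n%:R : F)) := triple_sumS n1 n2 n3 k.
rewrite !natrD pair_sum_eigen // -/M => e.
have e3 : (if (n3 <= k)%N then pair_sum n1 n2 (k - n3)%N else 0%N)%:R =
    \sum_(0 <= m < k.+1 - n3) eigen_term F n1 n2 m.
  case: leqP => [le3|gt3]; last by rewrite (_ : _ - _ = 0)%N ?big_geq //; lia.
  rewrite pair_sum_eigen; last by lia.
  by congr (\sum_(0 <= m < _) _); move: leM; rewrite /M; lia.
apply/eqP; rewrite subr_eq -(inj_eq (addIr (\sum_(0 <= m < k.+1 - n3) eigen_term F n1 n2 m))).
rewrite e3 in e; rewrite {}e addrC (big_cat_nat (leq0n _) (leqW leM)) /= addrC -!addrA.
by rewrite eq_sym; apply/eqP; ring.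
Qed.

Lemma sum_eigen_closed (F : numFieldType) n1 n2 l mu :
  \sum_(l <= m < (l + mu).+1) eigen_term F n1 n2 m =
  (mu%:R + 1) * (l%:R ^+ 2 + n1%:R * n2%:R - (l%:R + mu%:R / 2%:R) * (n1%:R + n2%:R)
               + (l%:R + mu%:R / 3%:R) * (mu%:R - 1)).
Proof.
under eq_bigr do rewrite eigen_termE.
by rewrite -addnS sum_quadratic -natr1; field.
Qed.

(** * Spherical functions of two-row shapes *)

Section Intervals.

Variables n1 n2 n3 : nat.
Local Notation N := (n1 + n2 + n3)%N.

(** 0, 1 or 2, according to the interval containing i. *)
Definition interval_index (i : 'I_N) : nat := ((n1 <= i) + (n1 + n2 <= i))%N.
Local Notation cl := interval_index.

Lemma young_subgroupE : young_subgroup n1 n2 n3 = class_perms cl.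
Proof.
have stabP (S : {set 'I_N}) (h : 'S_N) :
    reflect (forall x, (h x \in S) = (x \in S)) (h \in 'N(S | 'P)%g).
  apply: (iffP idP) => [hS x | hS]; first by have := astabs_act x hS.
  rewrite !inE; apply/subsetP=> x; rewrite inE /= /aperm => xS.
  by rewrite hS.
apply/setP=> h; rewrite 2!in_setI; apply/idP/class_permP=> [|hcl].
  case/andP=> /andP[/stabP h1 /stabP h2] /stabP h3 x.
  by have := h1 x; have := h2 x; have := h3 x; rewrite !inE /cl; lia.
rewrite -andbA; apply/and3P; split; apply/stabP=> x; rewrite !inE;
  by have := hcl x; rewrite /cl; lia.
Qed.

Lemma interval_index3 i : ((cl i == 0) + (cl i == 1) + (cl i == 2) = 1)%N.
Proof. rewrite /cl; lia. Qed.

Lemma class_count_intervals i :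
  class_count cl setT i =
  (n1 * (i == 0) + n2 * (i == 1) + n3 * (i == 2))%N.
Proof.
have -> : class_count cl setT i = (\sum_(x < N) (cl x == i))%N.
  by rewrite class_countE; apply: eq_bigl => x; rewrite inE.
rewrite !big_split_ord /=.
under eq_bigr => x _.
  rewrite (_ : _ == _ = (i == 0)); last by have := ltn_ord x; rewrite /cl /=; lia.
  over.
under [X in (_ + X + _)%N]eq_bigr => x _.
  rewrite (_ : _ == _ = (i == 1)); last by have := ltn_ord x; rewrite /cl /=; lia.
  over.
under [X in (_ + X)%N]eq_bigr => x _.
  rewrite (_ : _ == _ = (i == 2)); last by have := ltn_ord x; rewrite /cl /=; lia.
  over.
by rewrite !sum_nat_const !card_ord.
Qed.

Lemma spherical_tperm k i1 i2 i3 (x y : 'I_N)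
    (n := fun i => class_count cl setT i) :
  (2 * k.+1 <= N)%N -> cl x = i1 -> cl y = i2 -> i1 != i2 ->
  (forall z, (cl z == i1) + (cl z == i2) + (cl z == i3) = 1)%N ->
  spherical [:: (N - k.+1)%N; k.+1] (tperm x y) =
  ((n i1)%:R * (n i2)%:R)^-1 *
  ((triple_sum (n i1) (n i2) (n i3) k.+1)%:R -
   (triple_sum (n i1) (n i2) (n i3) k)%:R).
Proof.
move=> lekN cx cy n12 cl3; rewrite /spherical young_subgroupE.
have n1_0 : (n i1)%:R != 0 :> algC.
  rewrite pnatr_eq0 -lt0n; apply/card_gt0P; exists x.
  by rewrite !inE cx eqxx.
have n2_0 : (n i2)%:R != 0 :> algC.
  rewrite pnatr_eq0 -lt0n; apply/card_gt0P; exists y.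
  by rewrite !inE cy eqxx.
have G0 : #|class_perms cl|%:R != 0 :> algC.
  by rewrite pnatr_eq0 -lt0n cardG_gt0.
have sumE m : (tperm_sum cl m x y)%:R = #|class_perms cl|%:R *
   (((n i1)%:R * (n i2)%:R)^-1 * (triple_sum (n i1) (n i2) (n i3) m)%:R) :> algC.
  apply: (mulfI (mulf_neq0 n1_0 n2_0)); rewrite mulrCA mulVKf ?mulf_neq0 //.
  by rewrite -!natrM (tperm_sum_profiles cl3 m cx cy n12).
under eq_bigr do rewrite specht_char_two_row //.
by rewrite sumrB -!natr_sum !sumE -!mulrBr mulKf.
Qed.

End Intervals.

Lemma mL_nat c k : mL c k = (k - c)%N%:Z.
Proof. rewrite /mL; lia. Qed.

Lemma mU_nat a b k : (k <= a + b)%N ->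
  mU a b k = (minn (minn a b) (minn k (a + b - k)))%:Z.
Proof. rewrite /mU; lia. Qed.

Lemma mL_le_mU a b c k : mL c k <= mU a b k ->
  (k <= a + b)%N /\ (k - c <= minn (minn a b) (minn k (a + b - k)))%N.
Proof.
move=> le; have kab : (k <= a + b)%N by move: le; rewrite /mL /mU; lia.
by move: le; rewrite mU_nat // mL_nat lez_nat.
Qed.

Lemma spherical_formulas (phi : algC) (a b c k : nat) :
  (0 < a)%N -> (0 < b)%N -> (0 < k)%N -> (2 * k <= a + b + c)%N ->
  phi = (a%:R * b%:R)^-1 * ((triple_sum a b c k)%:R - (triple_sum a b c k.-1)%:R) ->
  (mL c k <= mU a b k ->
       phi = (a%:R * b%:R)^-1 *
             \sum_(absz (mL c k) <= m < (absz (mU a b k)).+1)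
                ((m%:R - a%:R) * (m%:R - b%:R) - m%:R)
    /\ (let l : algC := (mL c k)%:~R in
        let mu : algC := (mU a b k - mL c k)%:~R in
        phi = (mu + 1) / (a%:R * b%:R) *
              (l ^+ 2 + a%:R * b%:R - (l + mu / 2%:R) * (a%:R + b%:R)
               + (l + mu / 3%:R) * (mu - 1))))
    /\ ((k <= minn a (minn b c))%N ->
          [/\ mL c k = 0, mU a b k = k%:Z
            & phi = (k%:R + 1) / (a%:R * b%:R) *
                    (a%:R * b%:R - 2%:R^-1 * k%:R * (a%:R + b%:R)
                     + 3%:R^-1 * k%:R * (k%:R - 1))]).
Proof.
case: k => // k a0 b0 _ leN /= phiE; set K := k.+1 in phiE *.
have closed : mL c K <= mU a b K ->
   let l : algC := (mL c K)%:~R in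
   let mu : algC := (mU a b K - mL c K)%:~R in
   phi = (mu + 1) / (a%:R * b%:R) *
              (l ^+ 2 + a%:R * b%:R - (l + mu / 2%:R) * (a%:R + b%:R)
               + (l + mu / 3%:R) * (mu - 1)).
  move=> /mL_le_mU[Kab leLU] l mu.
  rewrite phiE triple_sum_eigen //.
  rewrite -(subnKC leLU) sum_eigen_closed /l /mu mL_nat mU_nat //.
  rewrite subzn // -!pmulrn; set M := minn _ _.
  by rewrite [in RHS]mulrAC [RHS]mulrC mulrA.
split=> [le|leK].
  split; last exact: closed.
  have [Kab leLU] := mL_le_mU le.
  by rewrite phiE triple_sum_eigen // mL_nat mU_nat // !absz_nat.
have eL : mL c K = 0 by rewrite mL_nat; lia.
have eU : mU a b K = K%:Z by rewrite mU_nat; lia.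
split=> //; rewrite closed ?eL ?eU // subr0 -!pmulrn mulr0n expr0n /= !add0r.
congr (_ * _); rewrite -!mulrA !(mulrCA _ _^-1) !mulrA.
by rewrite ?[2%:R^-1 * _]mulrC ?[3%:R^-1 * _]mulrC.
Qed.

Unset Implicit Arguments.

Theorem mainTheorem1 (n1 n2 n3 k : nat)
    (n1_gt0 : (0 < n1)%N) (n2_gt0 : (0 < n2)%N) (n3_gt0 : (0 < n3)%N)
    (k_gt0 : (1 <= k)%N) (k_le : (2 * k <= n1 + n2 + n3)%N) :
  (* the first elements of the three intervals *)
  let x1 : 'I_(n1 + n2 + n3) := lshift n3 (lshift n2 (Ordinal n1_gt0)) in
  let x2 : 'I_(n1 + n2 + n3) := lshift n3 (rshift n1 (Ordinal n2_gt0)) in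
  let x3 : 'I_(n1 + n2 + n3) := rshift (n1 + n2) (Ordinal n3_gt0) in
  let Phi := @spherical n1 n2 n3 [:: (n1 + n2 + n3 - k)%N; k] in
  (* phi is the value of Phi at a transposition meeting the intervals of
     lengths a and b, and c is the length of the remaining interval *)
  let formulas (phi : algC) (a b c : nat) : Prop :=
    (mL c k <= mU a b k ->
       phi = (a%:R * b%:R)^-1 *
             \sum_(absz (mL c k) <= m < (absz (mU a b k)).+1)
                ((m%:R - a%:R) * (m%:R - b%:R) - m%:R)
    /\ (let l : algC := (mL c k)%:~R in
        let mu : algC := (mU a b k - mL c k)%:~R in
        phi = (mu + 1) / (a%:R * b%:R) *
              (l ^+ 2 + a%:R * b%:R - (l + mu / 2%:R) * (a%:R + b%:R)
               + (l + mu / 3%:R) * (mu - 1))))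
    /\ ((k <= minn a (minn b c))%N ->
          [/\ mL c k = 0, mU a b k = k%:Z
            & phi = (k%:R + 1) / (a%:R * b%:R) *
                    (a%:R * b%:R - 2%:R^-1 * k%:R * (a%:R + b%:R)
                     + 3%:R^-1 * k%:R * (k%:R - 1))])
  in
  [/\ formulas (Phi (tperm x1 x2)) n1 n2 n3,
      formulas (Phi (tperm x2 x3)) n2 n3 n1
    & formulas (Phi (tperm x1 x3)) n1 n3 n2].
Proof.
move=> x1 x2 x3 Phi formulas; rewrite /Phi {Phi}.
case: k k_gt0 k_le @formulas => // k _ k_le formulas.
have cl1 : interval_index x1 = 0%N by rewrite /interval_index /=; lia.
have cl2 : interval_index x2 = 1%N by rewrite /interval_index /=; lia.
have cl3 : interval_index x3 = 2%N by rewrite /interval_index /=; lia.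
have N1 : class_count (@interval_index n1 n2 n3) setT 0%N = n1.
  by rewrite class_count_intervals /=; lia.
have N2 : class_count (@interval_index n1 n2 n3) setT 1%N = n2.
  by rewrite class_count_intervals /=; lia.
have N3 : class_count (@interval_index n1 n2 n3) setT 2%N = n3.
  by rewrite class_count_intervals /=; lia.
have cls := @interval_index3 n1 n2 n3.
split; apply: spherical_formulas => //; try lia.
- by rewrite (spherical_tperm k_le cl1 cl2 (i3 := 2%N)) ?N1 ?N2 ?N3.
- rewrite (spherical_tperm k_le cl2 cl3 (i3 := 0%N)) ?N1 ?N2 ?N3 // => z.
  by have := cls z; lia.
- rewrite (spherical_tperm k_le cl1 cl3 (i3 := 1%N)) ?N1 ?N2 ?N3 // => z.
  by have := cls z; lia.
Qed.
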